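(* Let $G$ be a group with a collection of subgroups $\mathcal{H}$ satisfying: (i) for every $H \in \mathcal{H}$ and every $h \in H$, the centralizer of $h$ in $G$ is not virtually cyclic; (ii) for every $g \in G$ and every integer $N \geq 1$, there exist an integer $n \geq N$ and a subgroup $H \in \mathcal{H}$ such that $H \cap H^{g^{n}}$ is infinite. Then $G$ is not acylindrically hyperbolic.
   Context: For a subgroup $H \leq G$ and $a \in G$, $H^{a}$ denotes the conjugate $aHa^{-1}$. An action by isometries of a group $G$ on a metric space $X$ is acylindrical if for every $d \geq 0$ there exist $R, N \geq 0$ such that for all $x,y \in X$ with $d(x,y) \geq R$, one has $\#\{ g \in G \mid d(x,gx) \leq d \text{ and } d(y,gy) \leq d \} \leq N$. If $X$ is a (Gromov-)hyperbolic metric space, the action is non elementary if the limit set $\Lambda(G)$ of $G$ (the set of accumulation points of an orbit in the Gromov boundary $\partial X$) is infinite. A group is acylindrically hyperbolic if it admits a non elementary acylindrical action by isometries on a hyperbolic space. *)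

(* Defs.v *)
From mathcomp Require Import all_boot all_order all_algebra.
From mathcomp Require Import all_classical all_reals topology normedtype.

Set Implicit Arguments.
Unset Strict Implicit.
Unset Printing Implicit Defensive.

Import Order.TTheory GRing.Theory Num.Theory.
Local Open Scope classical_set_scope.
Local Open Scope ring_scope.
Local Open Scope card_scope.

Section Groups.
Variable G : groupType.
Implicit Types (H K : set G) (a c h : G).

Definition subgroup H : Prop := group_closed [in H].

(* H^a = a H a^-1; beware that the library's [x ^ a] is a^-1 x a. *)
Definition conj_subgroup H a : set G := [set (a * h * a^-1)%g | h in H].

Definition centralizer h : set G := [set x | commute h x].

Definition cyclic_subgroup c : set G :=
  [set x | exists n : nat, x = (c ^+ n)%g \/ x = (c ^- n)%g].

Definition left_cosets K H : set (set G) :=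
  [set [set (x * y)%g | y in H] | x in K].

(* In particular, every finite group is virtually cyclic (take c = 1). *)
Definition virtually_cyclic K : Prop :=
  exists2 c, K c & finite_set (left_cosets K (cyclic_subgroup c)).

End Groups.

Section Hyperbolic.
Variables (R : realType) (X : metricType R).
Implicit Types (o x y z : X) (u v : nat -> X) (xi : set (nat -> X)).

Definition gromov_product o x y : R :=
  (mdist x o + mdist y o - mdist x y) / 2.

(* The space is not required to be geodesic or proper. *)
Definition hyperbolic : Prop :=
  exists2 delta : R, 0 <= delta &
    forall o x y z,
      Num.min (gromov_product o x y) (gromov_product o y z) - delta
        <= gromov_product o x z.

(* (u_i | v_j)_o tends to infinity as i and j do; the property does not depend
   on the basepoint o. *)
Definition asymptotic u v : Prop :=
  forall o, (fun p : nat * nat => gromov_product o (u p.1) (v p.2))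
              @ (\oo, \oo) --> +oo.

Definition converges_at_infinity u : Prop := asymptotic u u.

(* The class of a sequence that converges at infinity. *)
Definition boundary_class u : set (nat -> X) :=
  [set v | converges_at_infinity v /\ asymptotic u v].

(* The (sequential) Gromov boundary: its points are the equivalence classes of
   sequences converging at infinity. *)
Definition gromov_boundary : set (set (nat -> X)) :=
  [set boundary_class u | u in [set u | converges_at_infinity u]].

(* A sequence u of points of X converges to the boundary point xi iff it
   belongs to the class xi. *)
Definition accumulation_points (A : set X) : set (set (nat -> X)) :=
  [set xi | gromov_boundary xi /\ exists2 u, (forall n, A (u n)) & xi u].

End Hyperbolic.
Arguments hyperbolic {R} X.

Section Actions.
Variables (R : realType) (G : groupType) (X : metricType R).
Implicit Types (act : G -> X -> X) (x : X).

Record isometric_action act : Prop := {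
  act1 : forall x, act 1%g x = x;
  actM : forall g h x, act (g * h)%g x = act g (act h x);
  act_isometry : forall g x y, mdist (act g x) (act g y) = mdist x y
}.

Definition acylindrical act : Prop :=
  forall d : R, 0 <= d ->
    exists (r : R) (N : nat), 0 <= r /\
      forall x y, r <= mdist x y ->
        [set g | mdist x (act g x) <= d /\ mdist y (act g y) <= d] #<= `I_N.

Definition limit_set act x : set (set (nat -> X)) :=
  accumulation_points (range (act ^~ x)).

(* The limit set does not depend on the orbit when X is hyperbolic; the
   existential makes an action on the empty space elementary. *)
Definition non_elementary act : Prop :=
  exists x, infinite_set (limit_set act x).

End Actions.

Definition acylindrically_hyperbolic (R : realType) (G : groupType) : Prop :=
  exists (X : metricType R) (act : G -> X -> X),
    [/\ hyperbolic X, isometric_action act, acylindrical act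
      & non_elementary act].

(* Main.v *)
Require Import Defs.
From mathcomp Require Import all_boot all_order all_algebra.
From mathcomp Require Import all_classical all_reals topology normedtype.
From mathcomp Require Import lra finmap.

(** Suppose that G acts acylindrically and non-elementarily on a hyperbolic
    space X, and let |g|_x denote the displacement d(x, g x).  Everything below
    rests on the four-point inequality
      d(x,z) + d(y,w) <= max (d(x,y) + d(z,w), d(x,w) + d(y,z)) + e;
    no geodesic is ever used, since X need not be geodesic.

    Call g loxodromic when |g^2|_x > |g|_x + e for some x.  The four-point
    inequality then makes |g^n|_x grow at least linearly
    ([displacement_expgD]).  Two facts make this threshold useful.

    - If a, b and ab are not loxodromic, then
      |ab|_x <= max (|a|_x, |b|_x) + 3e ([non_loxodromic_ultrametric]): up to an
      additive error, a group without loxodromic elements has an ultrametric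
      displacement, as if it fixed a point of X or of its boundary.  If no
      element of G were loxodromic, any two sequences going to infinity in an
      orbit would thus be asymptotic, and the limit set would have at most one
      point.  Hence G contains a loxodromic g ([exists_loxodromic]).

    - The centralizer of a loxodromic h is virtually cyclic
      ([loxodromic_centralizer]): in each coset of the powers of h, an element c
      that nearly minimizes |c|_x has |c|_x bounded, and it displaces all the
      points h^k x equally, so that acylindricity leaves finitely many such c.
      Hence (i) says that no element of a subgroup of the collection is
      loxodromic.

    Now fix a base point x and the loxodromic g, let p = g^n for a large n, and
    let H be the subgroup that (ii) provides.  The picture is that of a tree,
    where H fixes a point P: the intersection K of H and p H p^-1 fixes both P
    and p P, so it fixes the path between them, which follows the axis of g for
    about the translation length of p.  To get this from the four-point
    inequality alone, take a finite subset F of K, and consider F together with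
    p^-1 F p; all these elements lie in H.  Move along the orbit of x under the
    powers of g as long as their largest displacement decreases
    ([displacement_decrease]).  When it no longer does, the element s that
    realizes it displaces the base point transversally to the axis on both
    sides; since s and its conjugate by p or by p^-1 lie in a common conjugate
    of H, the ultrametric inequality for these two elements bounds |s|
    ([transverse_bounded]).  The bound does not depend on n.  So there is a point
    y such that F displaces both y and p y by a bounded amount
    ([common_small_displacement]).  As d(y, p y) is large, acylindricity bounds
    the size of F, and K is finite, against (ii). *)

Set Implicit Arguments.
Unset Strict Implicit.
Unset Printing Implicit Defensive.

Import Order.TTheory GRing.Theory Num.Theory.
Local Open Scope classical_set_scope.
Local Open Scope ring_scope.
Local Open Scope card_scope.

(** * The four-point inequality *)

Section FourPoint.
Variables (R : realType) (X : metricType R).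

(** The maximum is written as a disjunction so that each use is a case split
    between linear inequalities. *)
Definition four_point (e : R) : Prop := forall x y z w : X,
  mdist x z + mdist y w <= mdist x y + mdist z w + e \/
  mdist x z + mdist y w <= mdist x w + mdist y z + e.

Lemma hyperbolic_four_point :
  hyperbolic X -> exists2 e : R, 0 <= e & four_point e.
Proof.
move=> [delta delta0 hyp]; exists (2 * delta) => [|x y z w]; first by lra.
move: (hyp w x y z); rewrite /gromov_product lerBlDr ge_min.
by case/orP => ?; [left | right]; lra.
Qed.

End FourPoint.

(** * Displacements and non-loxodromic elements *)

Section Displacement.
Variables (R : realType) (G : groupType) (X : metricType R) (act : G -> X -> X).
Hypothesis act_iso : isometric_action act.
Implicit Types (g h a b s t p q : G) (x y : X).

Definition displacement g x : R := mdist x (act g x).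

Local Notation "‖ g ‖_ x" := (displacement g%g x)
  (at level 0, g at level 99, x at level 2, format "‖ g ‖_ x").

Lemma mdist_orbit g h x : mdist (act g x) (act h x) = ‖g^-1 * h‖_x.
Proof.
by rewrite -(act_isometry act_iso g^-1) -!(actM act_iso) mulVg (act1 act_iso).
Qed.

Lemma mdist_orbitl g x : mdist (act g x) x = ‖g^-1‖_x.
Proof. by rewrite -{2}[x](act1 act_iso) mdist_orbit mulg1. Qed.

Lemma displacementV g x : ‖g^-1‖_x = ‖g‖_x.
Proof. by rewrite -mdist_orbitl metric_sym. Qed.

Lemma displacement_act g h x : ‖g‖_(act h x) = ‖h^-1 * g * h‖_x.
Proof. by rewrite /displacement -(actM act_iso) mdist_orbit mulgA. Qed.

Lemma displacement_ge0 g x : 0 <= ‖g‖_x.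
Proof. exact: mdist_ge0. Qed.

Lemma displacementM g h x : ‖g * h‖_x <= ‖g‖_x + ‖h‖_x.
Proof.
have := metric_triangle x (act g x) (act (g * h) x).
by rewrite mdist_orbit mulKg.
Qed.

Variable e : R.
Hypothesis e_ge0 : 0 <= e.
Hypothesis X4 : four_point X e.

(** The four-point inequality for points of one orbit: all the distances become
    displacements of words at the same point, which free reduction
    normalizes. *)
Lemma displacement_four_point g h k x :
  ‖h‖_x + ‖g^-1 * k‖_x <= ‖g‖_x + ‖h^-1 * k‖_x + e \/
  ‖h‖_x + ‖g^-1 * k‖_x <= ‖k‖_x + ‖g^-1 * h‖_x + e.
Proof. by move: (X4 x (act g x) (act h x) (act k x)); rewrite !mdist_orbit. Qed.

(** An element of zero translation length satisfies this at every point, and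
    conversely an element that violates it at some point has positive
    translation length ([displacement_expgD]). *)
Definition non_loxodromic g : Prop :=
  forall x, ‖g * g‖_x <= ‖g‖_x + e.

Lemma non_loxodromicJ g h :
  non_loxodromic g -> non_loxodromic (h^-1 * g * h)%g.
Proof.
move=> g_nl x; move: (g_nl (act h x)); rewrite !displacement_act.
by rewrite !gnorm.
Qed.

(** By induction, using the four-point inequality for x, g x, g^2 x and
    g^(n+2) x: the induction hypothesis |g^n| < |g^(n+1)| rules out the first of
    its two alternatives. *)
Lemma displacement_expgS g x (r : R) n :
  0 < r -> ‖g‖_x + e + r <= ‖g * g‖_x ->
  ‖g ^+ n‖_x + r <= ‖g ^+ n.+1‖_x.
Proof.
move=> r_gt0 g_lox; elim: n => [|n IHn].
  rewrite expg0 expg1 {1}/displacement (act1 act_iso) mdistxx.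
  by have := displacementM g g x; have := e_ge0; lra.
have := displacement_four_point g (g * g) (g ^+ n.+2) x.
have -> : (g^-1 * g ^+ n.+2 = g ^+ n.+1)%g by rewrite expgS mulKg.
have -> : ((g * g)^-1 * g ^+ n.+2 = g ^+ n)%g.
  by rewrite !expgS [X in (_ * X)%g]mulgA mulKg.
rewrite mulKg.
by case; lra.
Qed.

Lemma displacement_expgD g x (r : R) n k :
  0 < r -> ‖g‖_x + e + r <= ‖g * g‖_x ->
  ‖g ^+ n‖_x + r *+ k <= ‖g ^+ (n + k)‖_x.
Proof.
move=> r_gt0 g_lox; elim: k => [|k IHk]; first by rewrite addn0 mulr0n addr0.
have := displacement_expgS (n + k) r_gt0 g_lox.
by rewrite addnS mulrSr; lra.
Qed.

(** If |ab| were too large, the path x, a x, ab x, aba x, abab x would be a local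
    quasi-geodesic, so |abab| would exceed |ab| by more than e, against the
    hypothesis on ab. *)
Lemma non_loxodromic_ultrametric a b x :
  non_loxodromic a -> non_loxodromic b -> non_loxodromic (a * b)%g ->
  ‖a * b‖_x <= Num.max ‖a‖_x ‖b‖_x + 3 * e.
Proof.
move=> /(_ x) a_nl /(_ x) b_nl /(_ x) ab_nl.
rewrite leNgt; apply/negP => ab_gt.
have a_le : ‖a‖_x <= Num.max ‖a‖_x ‖b‖_x by rewrite le_max lexx.
have b_le : ‖b‖_x <= Num.max ‖a‖_x ‖b‖_x by rewrite le_max lexx orbT.
set M := Num.max _ _ in ab_gt a_le b_le.
have e0 := e_ge0.
have Va := displacementV a x; have Vb := displacementV b x.
have Vba : ‖a^-1 * b^-1‖_x = ‖b * a‖_x by rewrite -displacementV !gnorm.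
(* As a is not loxodromic, a x and a^-1 x start in the same direction from x, and
   so do b x and b^-1 x; hence d(a^-1 x, b x) and d(b^-1 x, a x) are comparable. *)
have ba_ge : ‖a * b‖_x - 2 * e <= ‖b * a‖_x.
  have := displacement_four_point a^-1 a b x.
  have := displacement_four_point a b^-1 b x.
  by rewrite !gnorm => -[] ? -[] ?; lra.
have aba_ge : 2 * ‖a * b‖_x - ‖b‖_x - 3 * e <= ‖a * b * a‖_x.
  have := displacement_four_point a (a * b) (a * b * a) x.
  by rewrite !gnorm => -[] ?; lra.
move: ab_nl (displacement_four_point (a * b) (a * b * a) (a * b * a * b) x).
rewrite !gnorm => ab_nl -[] ?; lra.
Qed.

Lemma non_loxodromicV g : non_loxodromic g -> non_loxodromic g^-1%g.
Proof.
by move=> g_nl x; rewrite -invgM !displacementV.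
Qed.

(** Let |p| <= |c|.  If p x and p^-1 x were not nearer to c x than x is, the four-point
    inequality for x, p x, p c x, c x would put all three points p^-1 x, x, p x
    at distance about |c| from c x.  Points equidistant from a given one form an
    ultrametric space up to an additive error, so |p^2| would not exceed |p|. *)
Lemma commuting_displacement_decrease p c x :
  commute p c -> ‖p‖_x <= ‖c‖_x -> ‖p‖_x + 2 * e + 1 < ‖p * p‖_x ->
  ‖p * c‖_x <= ‖c‖_x - 1 \/ ‖p^-1 * c‖_x <= ‖c‖_x - 1.
Proof.
move=> pc p_le p_lox.
case: (leP ‖p * c‖_x (‖c‖_x - 1)) => [?|pc_gt]; first by left.
case: (leP ‖p^-1 * c‖_x (‖c‖_x - 1)) => [?|pVc_gt]; first by right.
have [Vp VpVc] := (displacementV p x, displacementV (p^-1 * c) x).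
have pVc := commute_sym (commuteV (commute_sym pc)).
have E1 : (c^-1 * p^-1 * c = p^-1)%g by rewrite -mulgA pVc mulKg.
have E2 : ‖c^-1 * p^-1‖_x = ‖p * c‖_x by rewrite -displacementV !gnorm.
have E3 : ‖p^-1 * p^-1‖_x = ‖p * p‖_x by rewrite -displacementV !gnorm.
move: VpVc E2 E3 (displacement_four_point p (p * c) c x).
move: (displacement_four_point p c p^-1 x).
rewrite !gnorm E1 Vp.
have e0 := e_ge0.
by move=> ? ? ? [] ? [] ?; lra.
Qed.

(** In the next two lemmas, the hypothesis |s| - k <= |s^-1 q| says that s x is
    almost as far from q x as from x, as happens when the path from x to s x
    leaves at a right angle the path from x to q x.  Then s x also leaves at a
    right angle the path to a point p x that lies beyond q x. *)
Lemma transverse_propagates s p q x (k : R) :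
  ‖s‖_x - k <= ‖s^-1 * q‖_x -> ‖q^-1 * p‖_x + k + e < ‖p‖_x ->
  ‖s‖_x + ‖p‖_x - ‖q‖_x - k - e <= ‖s^-1 * p‖_x.
Proof.
move=> s_q p_far; have Vqp := displacementV (q^-1 * p) x.
move: Vqp (displacement_four_point s p q x).
by rewrite !gnorm => ? [] ?; lra.
Qed.

(** Let t = p s p^-1.  The path from x to p x leaves at a right angle both the path
    from x to s x and the path from p x to t p x.  So t moves x in the direction
    of p x, and s moves it in a direction transverse to this one, which would
    make |s^-1 t| about |s| + |t|; the ultrametric inequality forces |s| to be
    small.  The bound is independent of p. *)
Lemma transverse_bounded s p q x (k : R) :
  0 <= k -> commute p q ->
  non_loxodromic s -> non_loxodromic (s^-1 * (p * s * p^-1))%g ->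
  ‖s‖_x - k <= ‖s^-1 * q‖_x -> ‖s‖_x - k <= ‖s^-1 * q^-1‖_x ->
  ‖q^-1 * p‖_x + k + 2 * e < ‖p‖_x ->
  3 * (‖q‖_x + k + 2 * e) + 2 * e < 2 * ‖p‖_x ->
  ‖s‖_x <= ‖q‖_x + k + 6 * e.
Proof.
move=> k_ge0 pq s_nl st_nl s_q s_qV p_far p_long.
have e0 := e_ge0.
rewrite leNgt; apply/negP => s_long.
have [Vs [Vp Vq]] := (displacementV s x, (displacementV p x, displacementV q x)).
have Vqp : ‖q * p^-1‖_x = ‖q^-1 * p‖_x.
  by rewrite -displacementV !gnorm (commuteV pq).
(* As s is not loxodromic, s x and s^-1 x start in the same direction. *)
have sV_qV : ‖s^-1‖_x - (k + e) <= ‖s * q^-1‖_x.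
  move: (s_nl x) (displacement_four_point s s^-1 q^-1 x).
  have : ‖s^-1 * s^-1‖_x = ‖s * s‖_x by rewrite -displacementV !gnorm.
  by rewrite !gnorm => ? ? [] ?; lra.
have s_p : ‖s‖_x + ‖p‖_x - ‖q‖_x - k - e <= ‖s^-1 * p‖_x.
  by apply: transverse_propagates => //; lra.
have s_pV : ‖s‖_x + ‖p^-1‖_x - ‖q^-1‖_x - k - e <= ‖s^-1 * p^-1‖_x.
  by apply: transverse_propagates => //; rewrite !gnorm; lra.
have sV_pV : ‖s^-1‖_x + ‖p^-1‖_x - ‖q^-1‖_x - (k + e) - e
    <= ‖s^-1^-1 * p^-1‖_x.
  by apply: transverse_propagates => //; rewrite !gnorm; lra.
have Vps : ‖s^-1 * p^-1‖_x = ‖p * s‖_x by rewrite -displacementV !gnorm.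
have Vsp : ‖p * s^-1‖_x = ‖s * p^-1‖_x by rewrite -displacementV !gnorm.
have sp_le := displacementM s p^-1 x.
have t_ge : ‖s‖_x + 2 * ‖p‖_x - 2 * (‖q‖_x + k + 2 * e) - e
    <= ‖p * s * p^-1‖_x.
  move: sV_pV (displacement_four_point p (p * s) (p * s * p^-1) x).
  by rewrite !gnorm => ? [] ?; lra.
have : ‖s‖_x + ‖p * s * p^-1‖_x - (‖q‖_x + k + 2 * e) - e
    <= ‖s^-1 * (p * s * p^-1)‖_x.
  move: (displacement_four_point s (p * s * p^-1) p x).
  by rewrite !gnorm => -[] ?; lra.
have := non_loxodromic_ultrametric x (non_loxodromicV s_nl) _ st_nl.
rewrite Vs => /(_ _)/wrap[].
  by have := non_loxodromicJ p^-1 s_nl; rewrite !gnorm.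
by have := displacement_ge0 q x; case: (leP ‖s‖_x); lra.
Qed.

(** The angle defect for which [displacement_decrease] gains exactly one unit. *)
Local Notation margin := ((3 * e + 1) / 2).

(** The element s has the largest displacement, and q x lies in the direction of
    s x.  An element u of almost the same displacement moves x in the same
    direction by the ultrametric inequality, so passing to q x decreases |u|; an
    element u of much smaller displacement cannot catch up. *)
Lemma displacement_decrease s u q x :
  ‖u‖_x <= ‖s‖_x ->
  ‖u^-1 * s‖_x <= ‖s‖_x + 3 * e -> ‖u * s‖_x <= ‖s‖_x + 3 * e ->
  ‖s^-1 * q‖_x <= ‖s‖_x - margin ->
  3 * ‖q‖_x + 8 * e + 2 < ‖s‖_x ->
  ‖q^-1 * u * q‖_x <= ‖s‖_x - 1.
Proof.
move=> u_le uVs us s_q s_long; have e0 := e_ge0.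
have q0 := displacement_ge0 q x.
have [Vu [Vq Vs]] := (displacementV u x, (displacementV q x, displacementV s x)).
case: (leP ‖u‖_x (‖s‖_x - 2 * ‖q‖_x - 1)) => [u_short|u_long].
  have := displacementM (q^-1 * u) q x; have := displacementM q^-1 u x; lra.
have u_q : ‖u^-1 * q‖_x <= ‖u‖_x - margin + e.
  by move: (displacement_four_point u s q x) => -[] ?; lra.
have uV_q : ‖u * q‖_x <= ‖u‖_x - margin + e.
  by move: (displacement_four_point u^-1 s q x); rewrite !gnorm => -[] ?; lra.
have : ‖q^-1 * u‖_x = ‖u^-1 * q‖_x by rewrite -displacementV !gnorm.
move: (displacement_four_point q u (u * q) x).
by rewrite !gnorm => -[] ? ?; lra.
Qed.

End Displacement.

(** * Maxima and descent *)

Section Reals.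
Variable R : realType.

Lemma exists_mulrn_gt (r C : R) : 0 < r -> exists n, C < r *+ n.
Proof.
move=> r_gt0; exists (Num.truncn (C / r)).+1.
by rewrite -mulr_natr mulrC -ltr_pdivrMr// truncnS_gt.
Qed.

(** Replaces the choice of a minimizer, which need not exist: P t L says that t is
    admissible with value at most L. *)
Lemma unit_descent (T : Type) (P : T -> R -> Prop) (C : R) :
  (forall t L, P t L -> 0 <= L) ->
  (forall t L, P t L -> exists t', P t' C \/ P t' (L - 1)) ->
  forall t L, P t L -> exists t', P t' C.
Proof.
move=> P_ge0 step t L PtL.
have {PtL} [n [{}t [{}L [L_lt PtL]]]] :
    exists (n : nat) t L, L < n%:R /\ P t L.
  by exists (Num.truncn L).+1, t, L; rewrite truncnS_gt.
elim: n t L L_lt PtL => [|n IHn] t L L_lt PtL.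
  by have := P_ge0 _ _ PtL; rewrite leNgt L_lt.
have [t' [?|Pt'L]] := step _ _ PtL; first by exists t'.
by apply: IHn Pt'L; rewrite ltrBlDr -natr1 in L_lt *.
Qed.

Lemma exists_max_seq (T : eqType) (f : T -> R) (s : seq T) t0 :
  t0 \in s -> exists2 t, t \in s & forall u, u \in s -> f u <= f t.
Proof.
elim: s t0 => // a s IHs t0 _; case: s IHs => [_|b s IHs].
  by exists a; rewrite ?mem_head// => u; rewrite inE => /eqP ->.
have [t ts t_max] := IHs b (mem_head _ _).
have [a_le|a_gt] := leP (f a) (f t).
  exists t; first by rewrite inE ts orbT.
  by move=> u; rewrite inE => /orP[/eqP -> //|/t_max].
exists a; first exact: mem_head.
move=> u; rewrite inE => /orP[/eqP -> //|/t_max]/le_trans; apply.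
exact: ltW.
Qed.

End Reals.

(** * Subgroups and cosets of cyclic subgroups *)

Section Groups.
Variable G : groupType.
Implicit Types (g h c : G) (H K : set G).

Lemma subgroupV H g : subgroup H -> H g -> H g^-1%g.
Proof.
by move=> /group_closedV HV Hg; have := HV g; rewrite !in_setE; apply.
Qed.

Lemma subgroupM H g h : subgroup H -> H g -> H h -> H (g * h)%g.
Proof.
by move=> /group_closedM HM; have := HM g h; rewrite !in_setE.
Qed.

Lemma cyclic_subgroupV c g : cyclic_subgroup c g -> cyclic_subgroup c g^-1%g.
Proof. by move=> [n [] ->]; exists n; rewrite ?invgK; [right|left]. Qed.

Lemma cyclic_subgroupM c g h :
  cyclic_subgroup c g -> cyclic_subgroup c h -> cyclic_subgroup c (g * h)%g.
Proof.
have mixed m n : cyclic_subgroup c (c ^+ m * c ^- n)%g.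
  have [mn|nm] := leqP n m.
    by exists (m - n)%N; left; rewrite expgnFr.
  by exists (n - m)%N; right; rewrite expgnFr ?invgM ?invgK // ltnW.
move=> [m [] ->] [n [] ->].
- by exists (m + n)%N; left; rewrite expgnDr.
- exact: mixed.
- have -> : (c ^- m * c ^+ n = c ^+ n * c ^- m)%g; last exact: mixed.
  by apply/commute_sym/commuteV; apply: commuteX2.
- by exists (n + m)%N; right; rewrite expgnDr invgM.
Qed.

Lemma left_coset_eq c g h : cyclic_subgroup c h ->
  [set (g * h * y)%g | y in cyclic_subgroup c] =
  [set (g * y)%g | y in cyclic_subgroup c].
Proof.
move=> ch; apply/seteqP; split=> _ [y cy <-].
  by exists (h * y)%g; rewrite ?mulgA//; apply: cyclic_subgroupM.
exists (h^-1 * y)%g; last by rewrite -!mulgA mulVKg.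
by apply: cyclic_subgroupM => //; apply: cyclic_subgroupV.
Qed.

End Groups.

(** * Centralizers of loxodromic elements *)

Section Acylindrical.
Variables (R : realType) (G : groupType) (X : metricType R) (act : G -> X -> X).
Hypothesis act_iso : isometric_action act.
Variable e : R.
Hypothesis e_ge0 : 0 <= e.
Hypothesis X4 : four_point X e.
Hypothesis act_acyl : acylindrical act.
Implicit Types (g h a b s t p q : G) (x y : X).

Local Notation "‖ g ‖_ x" := (displacement act g%g x)
  (at level 0, g at level 99, x at level 2, format "‖ g ‖_ x").

Lemma displacement_commute g h x : commute g h -> ‖g‖_(act h x) = ‖g‖_x.
Proof. by move=> gh; rewrite displacement_act// -mulgA gh mulKg. Qed.

(** Descent inside the coset c <h> reaches a representative whose displacement is
    at most that of p = h^m, where m makes |p^2| - |p| large enough for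
    [commuting_displacement_decrease]. *)
Lemma loxodromic_centralizer h :
  ~ non_loxodromic act e h -> virtually_cyclic (centralizer h).
Proof.
move=> /existsNP[x /negP]; rewrite -ltNge => h_lox.
set r : R := ‖h * h‖_x - ‖h‖_x - e.
have r_gt0 : 0 < r by rewrite /r; lra.
have {}h_lox : ‖h‖_x + e + r <= ‖h * h‖_x by rewrite /r; lra.
have [m m_gt] := exists_mulrn_gt (2 * e + 1) r_gt0.
have p_lox : ‖h ^+ m‖_x + 2 * e + 1 < ‖h ^+ m * h ^+ m‖_x.
  rewrite -expgnDr; have := displacement_expgD act_iso e_ge0 X4 m m r_gt0 h_lox.
  by lra.
have [r0 [N [r0_ge0 acyl]]] := act_acyl (displacement_ge0 act (h ^+ m) x).
(* The representatives commute with h, so their displacements at x and at h^k x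
   coincide; these two points are far enough apart for acylindricity. *)
have [k k_gt] := exists_mulrn_gt r0 r_gt0.
have k_far : r0 <= ‖h ^+ k‖_x.
  have := displacement_expgD act_iso e_ge0 X4 0 k r_gt0 h_lox.
  by have := displacement_ge0 act (h ^+ 0) x; rewrite add0n; lra.
have /card_le_finite/(_ (finite_II N)) := acyl x (act (h ^+ k) x) k_far.
move=> /(finite_image (fun c => [set (c * y)%g | y in cyclic_subgroup h])) fin.
exists h; first exact: commute_refl.
apply: sub_finite_set fin => _ [c ch <-].
pose P z L := cyclic_subgroup h z /\ ‖c * z‖_x <= L.
have hm_comm c' : commute h c' -> commute (h ^+ m)%g c'.
  by move=> ?; apply/commute_sym/commuteX/commute_sym.
have h_cyc z : cyclic_subgroup h z -> commute h z.
  by case=> n [] ->; [|apply: commuteV]; apply: commuteX; apply: commute_refl.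
have hm_cyc : cyclic_subgroup h (h ^+ m)%g by exists m; left.
have h_cM z : cyclic_subgroup h z -> commute h (c * z)%g.
  by move=> hz; apply: commuteM; [apply: commute_sym|apply: h_cyc].
have [|||z [hz cz_le]] := @unit_descent R G P ‖h ^+ m‖_x _ _ 1%g ‖c‖_x.
- by move=> z L [_]; apply: le_trans; apply: displacement_ge0.
- move=> z L [hz cz_le].
  have [cz_small|cz_big] := leP ‖c * z‖_x ‖h ^+ m‖_x; first by exists z; left.
  have hcz := hm_comm _ (h_cM z hz).
  have [] := commuting_displacement_decrease act_iso e_ge0 X4 hcz (ltW cz_big) p_lox.
    exists (z * h ^+ m)%g; right; split; first exact: cyclic_subgroupM.
    by rewrite mulgA -hcz; lra.
  exists (z * h ^- m)%g; right; split.
    by apply: cyclic_subgroupM => //; apply: cyclic_subgroupV.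
  rewrite mulgA; have <- : (h ^- m * (c * z) = c * z * h ^- m)%g.
    exact/commute_sym/commuteV/commute_sym.
  by lra.
- by split; [exists 0; left|rewrite mulg1].
exists (c * z)%g; last exact: left_coset_eq.
have cz_h : commute (c * z)%g (h ^+ k)%g by apply/commuteX/commute_sym/h_cM.
split; first exact: cz_le.
by rewrite -/(displacement act _ _) displacement_commute.
Qed.

End Acylindrical.

(** * The boundary and the limit set *)

Section Boundary.
Variables (R : realType) (X : metricType R).
Implicit Types (u v w : nat -> X) (o x : X).

Lemma asymptoticP u v : asymptotic u v <->
  forall o (A : R), exists N : nat, forall i j : nat, (N <= i)%N -> (N <= j)%N ->
    A <= gromov_product o (u i) (v j).
Proof.
split=> [uv o A|uv o].
  move/cvgryPge: (uv o) => /(_ A) [[S T] /= [[m _ mS] [n _ nT]] ST].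
  exists (maxn m n) => i j; rewrite !geq_max => /andP[mi _] /andP[_ nj].
  by apply: (ST (i, j)); split; [apply: mS|apply: nT].
apply/cvgryPge => A; have [N uvN] := uv o A.
exists ([set i | (N <= i)%N], [set i | (N <= i)%N]) => /=.
  by split; exists N.
by case=> i j [/= Ni Nj]; apply: uvN.
Qed.

Lemma gromov_productC o x y : gromov_product o x y = gromov_product o y x.
Proof. by rewrite /gromov_product (metric_sym x y) addrC addrA addrAC; lra. Qed.

Lemma asymptotic_sym u v : asymptotic u v -> asymptotic v u.
Proof.
move=> /asymptoticP uv; apply/asymptoticP => o A; have [N uvN] := uv o A.
by exists N => i j Ni Nj; rewrite gromov_productC; apply: uvN.
Qed.

Lemma asymptotic_trans u v w :
  hyperbolic X -> asymptotic u v -> asymptotic v w -> asymptotic u w.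
Proof.
move=> [delta _ hyp] /asymptoticP uv /asymptoticP vw; apply/asymptoticP => o A.
have [[M uvM] [N vwN]] := (uv o (A + delta), vw o (A + delta)).
exists (maxn M N) => i j; rewrite !geq_max => /andP[Mi Ni] /andP[Mj Nj].
apply: le_trans (hyp o (u i) (v i) (w j)).
by rewrite lerBrDr le_min uvM// vwN.
Qed.

(** Changing the base point changes Gromov products by a bounded amount. *)
Lemma asymptotic_base u v o :
  (forall A : R, exists N : nat, forall i j : nat, (N <= i)%N -> (N <= j)%N ->
    A <= gromov_product o (u i) (v j)) -> asymptotic u v.
Proof.
move=> uv; apply/asymptoticP => o' A; have [N uvN] := uv (A + mdist o o').
exists N => i j Ni Nj; have := uvN i j Ni Nj; rewrite /gromov_product.
have := metric_triangle (u i) o' o; have := metric_triangle (v j) o' o.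
by rewrite (metric_sym o' o); lra.
Qed.

End Boundary.

Section LimitSet.
Variables (R : realType) (G : groupType) (X : metricType R) (act : G -> X -> X).
Hypothesis act_iso : isometric_action act.
Variable e : R.
Hypothesis e_ge0 : 0 <= e.
Hypothesis X4 : four_point X e.
Implicit Types (g h a b s t p q : G) (x y : X).

(** The Gromov product form of the ultrametric inequality. *)
Lemma gromov_product_orbit_ge a b x :
  non_loxodromic act e a -> non_loxodromic act e b ->
  non_loxodromic act e (a^-1 * b)%g ->
  Num.min (displacement act a x) (displacement act b x) - 3 * e
    <= 2 * gromov_product x (act a x) (act b x).
Proof.
move=> /(non_loxodromicV act_iso) aV_nl b_nl ab_nl.
have := non_loxodromic_ultrametric act_iso e_ge0 X4 x aV_nl b_nl ab_nl.
rewrite /gromov_product mdist_orbit// !mdist_orbitl// !displacementV//.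
by case: (leP (displacement act a x)); lra.
Qed.

(** The Gromov product of a x and b x goes to infinity with |a|_x and |b|_x, so
    all sequences of the orbit that go to infinity are asymptotic. *)
Lemma limit_set_subsingleton x :
  hyperbolic X -> (forall g, non_loxodromic act e g) ->
  forall xi eta, limit_set act x xi -> limit_set act x eta -> xi = eta.
Proof.
move=> hyp nl.
have orbit_asymptotic u v :
  (forall n, range (act ^~ x) (u n)) -> (forall n, range (act ^~ x) (v n)) ->
  converges_at_infinity u -> converges_at_infinity v -> asymptotic u v.
  move=> ux vx /asymptoticP uu /asymptoticP vv; apply: (@asymptotic_base _ _ _ _ x) => A.
  have [[M uuM] [N vvN]] := (uu x (2 * A + 3 * e), vv x (2 * A + 3 * e)).
  exists (maxn M N) => i j; rewrite !geq_max => /andP[Mi Ni] /andP[Mj Nj].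
  move: (uuM i i Mi Mi) (vvN j j Nj Nj).
  have [a _ <-] := ux i; have [b _ <-] := vx j.
  rewrite /gromov_product !mdistxx.
  have := gromov_product_orbit_ge x (nl a) (nl b) (nl _).
  rewrite !mdist_orbitl// !displacementV//.
  rewrite /gromov_product mdist_orbit// !mdist_orbitl// !displacementV//.
  by case: (leP (displacement act a x)); lra.
have incl xi eta : limit_set act x xi -> limit_set act x eta -> xi `<=` eta.
  move=> [[u u_cv <-] [u' u'x [u'_cv uu']]] [[v v_cv <-] [v' v'x [v'_cv vv']]].
  move=> w [w_cv uw]; split=> //.
  have v'u' := orbit_asymptotic _ _ v'x u'x v'_cv u'_cv.
  apply: (asymptotic_trans hyp vv'); apply: (asymptotic_trans hyp v'u').
  exact: asymptotic_trans hyp (asymptotic_sym uu') uw.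
by move=> xi eta ? ?; apply/seteqP; split; apply: incl.
Qed.

Lemma exists_loxodromic :
  hyperbolic X -> non_elementary act -> exists g, ~ non_loxodromic act e g.
Proof.
move=> hyp [x inf_x]; apply: contrapT => /forallNP no_lox.
have nl g : non_loxodromic act e g by apply: contrapT; apply: no_lox.
have [xi x_xi] := infinite_setN0 inf_x.
apply: inf_x; apply: (@sub_finite_set _ _ [set xi]); last exact: finite_set1.
by move=> eta x_eta; apply: limit_set_subsingleton x_eta x_xi.
Qed.

End LimitSet.

(** * Intersections with conjugates by large powers *)

Section Intersections.
Variables (R : realType) (G : groupType) (X : metricType R) (act : G -> X -> X).
Hypothesis act_iso : isometric_action act.
Variable e : R.
Hypothesis e_ge0 : 0 <= e.
Hypothesis X4 : four_point X e.
Implicit Types (g h a b s t p q : G) (x y : X) (H : set G).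

Local Notation "‖ g ‖_ x" := (displacement act g%g x)
  (at level 0, g at level 99, x at level 2, format "‖ g ‖_ x").

Local Notation margin := ((3 * e + 1) / 2).

Lemma subgroup_ultrametric H a b x :
  subgroup H -> (forall h, H h -> non_loxodromic act e h) -> H a -> H b ->
  ‖a * b‖_x <= Num.max ‖a‖_x ‖b‖_x + 3 * e.
Proof.
move=> sH H_nl Ha Hb; apply: non_loxodromic_ultrametric => //; apply: H_nl => //.
exact: subgroupM.
Qed.

(** Both s and p s p^-1 lie in p H p^-1, and conjugates of non-loxodromic elements
    are non-loxodromic. *)
Lemma intersection_transverse_bounded H s p q x :
  subgroup H -> (forall h, H h -> non_loxodromic act e h) -> commute p q ->
  H s -> H (p^-1 * s * p)%g ->
  ‖q^-1 * p‖_x + margin + 2 * e < ‖p‖_x ->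
  3 * (‖q‖_x + margin + 2 * e) + 2 * e < 2 * ‖p‖_x ->
  ‖s‖_x - margin < ‖s^-1 * q‖_x ->
  ‖s‖_x - margin < ‖s^-1 * q^-1‖_x ->
  ‖s‖_x <= 3 * ‖q‖_x + 8 * e + 2.
Proof.
move=> sH H_nl pq Hs Hsp p_far p_long /ltW s_q /ltW s_qV.
have e0 := e_ge0; have q0 := displacement_ge0 act q x.
have k_ge0 : 0 <= margin by lra.
have st_nl : non_loxodromic act e (s^-1 * (p * s * p^-1))%g.
  have -> : (s^-1 * (p * s * p^-1) =
             p^-1^-1 * ((p^-1 * s * p)^-1 * s) * p^-1)%g by rewrite !gnorm.
  apply: non_loxodromicJ => //; apply: H_nl; apply: subgroupM => //.
  exact: subgroupV.
have := transverse_bounded act_iso e_ge0 X4 k_ge0 pq (H_nl _ Hs) st_nl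
  s_q s_qV p_far p_long.
by lra.
Qed.

(** The descent moves x by q or q^-1 at each step.  The points z x that it visits
    are recorded through the fact that z commutes with p and q, which keeps |p|
    and |q| constant. *)
Lemma common_small_displacement H (F : seq G) p q x :
  subgroup H -> (forall h, H h -> non_loxodromic act e h) -> commute p q ->
  (forall s, s \in F -> H s /\ H (p^-1 * s * p)%g) ->
  ‖q^-1 * p‖_x + margin + 2 * e < ‖p‖_x ->
  3 * (‖q‖_x + margin + 2 * e) + 2 * e < 2 * ‖p‖_x ->
  exists2 z, commute z p & forall s, s \in F ->
    ‖s‖_(act z x) <= 3 * ‖q‖_x + 8 * e + 2 /\
    ‖s‖_(act p (act z x)) <= 3 * ‖q‖_x + 8 * e + 2.
Proof.
move=> sH H_nl pq FH p_far p_long; set C := 3 * ‖q‖_x + 8 * e + 2.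
have e0 := e_ge0; have q0 := displacement_ge0 act q x.
have C_ge0 : 0 <= C by rewrite /C; lra.
pose S := F ++ [seq p^-1 * s * p | s <- F]%g.
have SH s : s \in S -> H s.
  by rewrite mem_cat => /orP[/FH[]//|/mapP[u /FH[_ Hu] ->]].
pose P z L := [/\ commute z p, commute z q, 0 <= L
                & forall s, s \in S -> ‖s‖_(act z x) <= L].
have commute1g (r : G) : commute 1%g r by exact/commute_sym/commute1.
have [z [zp zq _ Sz]] : exists z, P z C.
  case: (boolP (nilp S)) => [/nilP S0|S_n0].
    exists 1%g; split=> //.
    by move=> s; rewrite S0.
  have [s0 s0S] : exists s, s \in S.
    by case: S S_n0 {SH P} => // s0 S' _; exists s0; rewrite mem_head.
  have [s1 s1S s1_max] := exists_max_seq (fun s => ‖s‖_x) s0S.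
  apply: (@unit_descent R G P C _ _ 1%g ‖s1‖_x); first by move=> z L [].
  - move=> z L [zp zq L0 SL]; set y := act z x in SL *.
    have [s sS s_max] := exists_max_seq (fun s => ‖s‖_y) s0S.
    have [s_small|s_big] := leP ‖s‖_y C.
      by exists z; left; split=> // u /s_max us; apply: le_trans s_small.
    have sL := SL s sS.
    have Ey g : commute z g -> ‖g‖_y = ‖g‖_x.
      by move=> zg; rewrite /y displacement_commute//; apply: commute_sym.
    (* If s displaces y towards r y, where r is q or q^-1, then all of S is
       displaced less at r y. *)
    have move_along r : commute r p -> commute r q -> ‖r‖_y = ‖q‖_x ->
        ‖s^-1 * r‖_y <= ‖s‖_y - margin ->
        exists t', P t' C \/ P t' (L - 1).
      move=> rp rq Er s_r; exists (r * z)%g; right; split.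
      + by apply/commute_sym/commuteM; apply: commute_sym.
      + by apply/commute_sym/commuteM; apply: commute_sym.
      + by rewrite /C in s_big; lra.
      move=> u uS; rewrite (actM act_iso) -/y displacement_act//.
      apply: le_trans (lerB sL (lexx 1)).
      have [Hu Hs] := (SH _ uS, SH _ sS); have us := s_max _ uS.
      have um b : H b -> ‖b‖_y = ‖u‖_y -> ‖b * s‖_y <= ‖s‖_y + 3 * e.
        move=> Hb bu; have := subgroup_ultrametric y sH H_nl Hb Hs.
        by rewrite bu (max_idPr us).
      apply: (displacement_decrease act_iso e_ge0 X4) => //.
      + by apply: um; [exact: subgroupV|exact: displacementV].
      + exact: um.
      + by rewrite Er.
    have [?|s_q] := leP ‖s^-1 * q‖_y (‖s‖_y - margin).
      by apply: (move_along q) => //; exact: Ey.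
    have [?|s_qV] := leP ‖s^-1 * q^-1‖_y (‖s‖_y - margin).
      apply: (move_along q^-1%g) => //.
      + by apply/commute_sym/commuteV.
      + exact/commute_sym/commuteV.
      + by rewrite displacementV// Ey.
    (* Otherwise s is transverse to the orbit of y on both sides.  An s of F is
       compared with its conjugate by p, an s of p^-1 F p with its conjugate by
       p^-1. *)
    suff : ‖s‖_y <= C by rewrite leNgt s_big.
    have Eq := Ey q zq; have Ep := Ey p zp.
    have Eqp : ‖q^-1 * p‖_y = ‖q^-1 * p‖_x.
      by apply: Ey; apply: commuteM => //; apply: commuteV.
    rewrite /C -Eq; have Hs := SH s sS.
    move: (sS); rewrite mem_cat => /orP[/FH[_ Hsp]|/mapP[k /FH[Hk _] Es]].
      by apply: (@intersection_transverse_bounded H s p q); rewrite ?Eq ?Ep ?Eqp.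
    have Eqp' : ‖q^-1^-1 * p^-1‖_y = ‖q^-1 * p‖_y.
      by rewrite -[RHS]displacementV// !gnorm (commuteV (commute_sym pq)).
    rewrite -(displacementV act_iso q).
    apply: (@intersection_transverse_bounded H s p^-1%g q^-1%g) => //.
    + by apply/commuteV/commute_sym/commuteV/commute_sym.
    + by rewrite Es !gnorm.
    + by rewrite Eqp' Eqp displacementV// Ep.
    + by rewrite !displacementV// Ep Eq.
    + by rewrite invgK.
  - split=> //; first exact: displacement_ge0.
    by move=> s /s1_max; rewrite (act1 act_iso).
exists z => // s sF; split; first by apply: Sz; rewrite mem_cat sF.
rewrite displacement_act//; apply: Sz; rewrite mem_cat; apply/orP; right.
exact: map_f.
Qed.

End Intersections.

(** * The theorem *)

Theorem theorem1p1 (R : realType) (G : groupType) (Hs : set (set G))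
    (Hs_subgroup : forall H, Hs H -> subgroup H)
    (Hs_centralizer : forall H h, Hs H -> H h ->
       ~ virtually_cyclic (centralizer h))
    (Hs_conj : forall (g : G) (N : nat), (1 <= N)%N ->
       exists n H, [/\ (N <= n)%N, Hs H &
         infinite_set (H `&` conj_subgroup H (g ^+ n)%g)]) :
  ~ acylindrically_hyperbolic R G.
Proof.
move=> [X [act [X_hyp act_iso act_acyl act_nel]]].
have [e e_ge0 X4] := hyperbolic_four_point X_hyp.
have [g /existsNP[x /negP]] := exists_loxodromic act_iso e_ge0 X4 X_hyp act_nel.
rewrite -ltNge => g_lox.
pose disp (g : G) : R := displacement act g x.
set r : R := (disp (g * g)%g - disp g - e).
have r_gt0 : 0 < r by rewrite /r /disp; lra.
have {}g_lox : (disp g + e + r <= disp (g * g)%g) by rewrite /r /disp; lra.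
have grow n k : disp (g ^+ n)%g + r *+ k <= disp (g ^+ (n + k))%g.
  exact: (displacement_expgD act_iso e_ge0 X4 n k r_gt0 g_lox).
(* Beyond g^m the quasi-geodesic has advanced enough for the transversality of
   [transverse_bounded]; the bound C depends on m only, and n is chosen after
   the constants that acylindricity gives for C. *)
have [m m_gt] := exists_mulrn_gt ((3 * e + 1) / 2 + 2 * e) r_gt0.
set q := (g ^+ m)%g in grow *; set C : R := (3 * disp q + 8 * e + 2).
have q0 : (0 <= disp q) by exact: displacement_ge0.
have C_ge0 : (0 <= C) by rewrite /C; lra.
have [r0 [N [r0_ge0 acyl]]] := act_acyl C C_ge0.
pose B : R := (3 * (disp q + (3 * e + 1) / 2 + 2 * e) + 2 * e).
have [n0 n0_gt] := exists_mulrn_gt (r0 + B) r_gt0.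
have [n [H [n_ge HH infK]]] := Hs_conj g (m + n0)%N.+1 isT.
set p := (g ^+ n)%g in infK *.
have p_gt : (r0 + B < disp p).
  have := grow 0%N n; rewrite add0n => /(lt_le_trans _)-> //.
  have := displacement_ge0 act (g ^+ 0)%g x; rewrite -/(disp _).
  have : (r *+ n0 <= r *+ n).
    by rewrite ler_pMn2l //; apply: leq_trans n_ge; rewrite -addSn leq_addl.
  lra.
have qp_far : (disp (q^-1 * p)%g + (3 * e + 1) / 2 + 2 * e < disp p).
  have m_le : (m <= n)%N by apply: leq_trans n_ge; rewrite leqW// leq_addr.
  have -> : (q^-1 * p = g ^+ (n - m))%g by rewrite /p -{1}(subnKC m_le) expgnDr mulKg.
  by have := grow (n - m)%N m; rewrite subnK //; lra.
have sH := Hs_subgroup _ HH.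
have H_nl h : H h -> non_loxodromic act e h.
  move=> Hh; apply: contrapT => /(loxodromic_centralizer act_iso e_ge0 X4 act_acyl).
  exact: Hs_centralizer HH Hh.
have pq : commute p q by apply: commuteX2.
have [F FK F_size] := infinite_set_fset N.+1 infK.
have FH s : s \in enum_fset F -> H s /\ H (p^-1 * s * p)%g.
  move=> sF; have [Hks [h Hh hs]] := FK s sF; split=> //.
  by rewrite -hs !gnorm.
have [|z zp Fz] := common_small_displacement act_iso e_ge0 X4 sH H_nl pq FH qp_far.
  by move: p_gt; rewrite /B -/(disp q) -/(disp p); have := displacement_ge0 act p x; lra.
have far : (r0 <= mdist (act z x) (act p (act z x))).
  rewrite -/(displacement act p _) displacement_commute // -/(disp p).
  by move: p_gt; rewrite /B; lra.
have : [set` F] #<= `I_N.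
  apply: card_le_trans (acyl _ _ far); apply: subset_card_le => s sF.
  exact: Fz.
by move=> /geq_card_fset_set; rewrite set_fsetK leqNgt F_size.
Qed.
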